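(* Any strong transversal $\mathbb{Z}$-affine structure on $(N,\mathcal{F})$ induces a transversal $\mathbb{Z}$-projective structure on $(N,\mathcal{F})$.
   Context: Let $(N,\mathcal{F})$ be a foliated manifold whose foliation has codimension $l\ge 0$. A transversal $\mathbb{Z}$-affine structure on $(N,\mathcal{F})$ is an atlas $\{(U_i,\chi_i)\}$ of submersions $\chi_i\colon U_i\to\mathbb{R}^l$ locally defining $\mathcal{F}$ such that, for all $i,j$ with $U_{ij}:=U_i\cap U_j\ne\varnothing$, there exists a smooth map $h_{ij}\colon\chi_i(U_{ij})\to\chi_j(U_{ij})$ which is (the restriction of) an element of $\mathrm{GL}(l;\mathbb{Z})\ltimes\mathbb{R}^l$ and satisfies $\chi_j|_{U_{ij}}=h_{ij}\circ\chi_i|_{U_{ij}}$. It is said to be strong if, for all $i,j$ with $U_{ij}\neq\varnothing$, $h_{ij}$ is (a restriction of) an element of $\mathrm{GL}(l;\mathbb{Z})\ltimes\mathbb{Z}^l$. A transversal $\mathbb{Z}$-projective structure on $(N,\mathcal{F})$ is an atlas $\{(U_i,\chi_i)\}$ of submersions $\chi_i\colon U_i\to\mathbb{R}\mathrm{P}^l$ locally defining $\mathcal{F}$ such that, for all $i,j$ with $U_{ij}\neq\varnothing$, there exists a smooth map $A_{ij}\colon U_{ij}\to\mathrm{GL}(l+1;\mathbb{Z})$ satisfying: $\chi_j=[A_{ij}]\circ\chi_i$ on $U_{ij}$, where $[A_{ij}]\colon\mathbb{R}\mathrm{P}^l\to\mathbb{R}\mathrm{P}^l$ is the map induced by $A_{ij}$;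 and $\{A_{ij}\}$ satisfies the cocycle condition. *)

(* Defs.v *)
From HB Require Import structures.
From mathcomp Require Import all_boot all_order all_algebra.
From mathcomp Require Import all_classical all_reals all_analysis.

Set Implicit Arguments.
Unset Strict Implicit.
Unset Printing Implicit Defensive.

Import Order.TTheory GRing.Theory Num.Theory.
Import numFieldNormedType.Exports.

Local Open Scope classical_set_scope.
Local Open Scope ring_scope.
Local Open Scope quotient_scope.

(* Points of R^n are column vectors, so that matrices act on the left. *)

Section smooth.
Variables (R : realType) (V W : normedModType R).

(* Used below for open D and finite-dimensional V, W only, where this is the
   usual notion of a C^k map on D, and depends on f only through its values
   on D. *)
Fixpoint ck_on (k : nat) (D : set V) (f : V -> W) : Prop :=
  match k with
  | 0 => forall x, D x -> {for x, continuous f}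
  | k'.+1 => (forall x, D x -> differentiable f x) /\
             (forall v, ck_on k' D (fun x => 'D_v f x))
  end.

Definition smooth_on (D : set V) (f : V -> W) : Prop :=
  forall k, ck_on k D f.

End smooth.

Section charts.
Variable R : realType.

(* Charts are partial homeomorphisms represented by total functions: the values
   of [cmap] outside [cdom] and of [cinv] outside [cmap @` cdom] are junk. *)
Record chart (T : topologicalType) (n : nat) := Chart {
  cdom : set T;
  cmap :> T -> 'cV[R]_n;
  cinv : 'cV[R]_n -> T
}.

Definition is_chart (T : topologicalType) (n : nat) (c : chart T n) : Prop :=
  [/\ open (cdom c),
      open (c @` cdom c),
      forall x, cdom c x -> cinv c (c x) = x,
      {within cdom c, continuous c} &
      {within c @` cdom c, continuous (cinv c)}].

Definition smooth_transition (T : topologicalType) (n : nat)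
    (c c' : chart T n) : Prop :=
  smooth_on (c @` (cdom c `&` cdom c')) (c' \o cinv c).

Record charted_space (n : nat) := ChartedSpace {
  carrier :> topologicalType;
  atlas : set (chart carrier n)
}.
Arguments atlas {n} c.

(* The atlas is not required to be maximal: it stands for the smooth structure
   that it generates. *)
Definition is_manifold (n : nat) (M : charted_space n) : Prop :=
  [/\ hausdorff_space M,
      @second_countable M,
      forall c, atlas M c -> is_chart c,
      forall x : M, exists2 c, atlas M c & cdom c x &
      forall c c', atlas M c -> atlas M c' -> smooth_transition c c'].

Section maps.
Variables (m q : nat) (M : charted_space m) (Q : charted_space q).

Definition local_rep (n : nat) (c : chart M n) (d : chart Q q) (f : M -> Q) :
  'cV[R]_n -> 'cV[R]_q := d \o f \o cinv c.

Definition smooth_map_on (U : set M) (f : M -> Q) : Prop :=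
  (forall x, U x -> {for x, continuous f}) /\
  (forall c d, atlas M c -> atlas Q d ->
     smooth_on (c @` (U `&` cdom c `&` f @^-1` cdom d)) (local_rep c d f)).

Definition submersion_on (U : set M) (f : M -> Q) : Prop :=
  smooth_map_on U f /\
  (forall x c d, U x -> atlas M c -> cdom c x -> atlas Q d -> cdom d (f x) ->
     set_surj setT setT ('d (local_rep c d f) (c x))).

End maps.

Section foliation.
Variables (k l : nat) (N : charted_space (k + l)).

(* A foliation of codimension l (and leaf dimension k) is given by an atlas of
   foliated charts, compatible with the smooth structure of N, whose changes of
   coordinates are locally of the form (x, y) |-> (g (x, y), h y), where
   x = usubmx z and y = dsubmx z are the leafwise and the transverse coordinates
   of z in R^(k + l). The smoothness of h follows from that of the change of
   coordinates. *)
Definition is_foliation (F : set (chart N (k + l))) : Prop :=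
  [/\ forall c, F c -> is_chart c,
      forall c a, F c -> atlas N a ->
        smooth_transition c a /\ smooth_transition a c,
      forall x : N, exists2 c, F c & cdom c x,
      forall c c', F c -> F c' -> smooth_transition c c' &
      forall c c' x, F c -> F c' -> cdom c x -> cdom c' x ->
        exists h : 'cV[R]_l -> 'cV[R]_l,
          \forall z \near c x, dsubmx (c' (cinv c z)) = h (dsubmx z)].

(* A submersion f on U locally defines F when ker (df_x) = T_x F for all x in U;
   in a foliated chart, T_x F is the space of vectors v with dsubmx v = 0. *)
Definition locally_defines (F : set (chart N (k + l))) (Q : charted_space l)
    (U : set N) (f : N -> Q) : Prop :=
  submersion_on U f /\
  (forall x c d, U x -> F c -> cdom c x -> atlas Q d -> cdom d (f x) ->
     forall v, 'd (local_rep c d f) (c x) v = 0 <-> dsubmx v = 0).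

Definition submersion_atlas (F : set (chart N (k + l))) (Q : charted_space l)
    (I : Type) (U : I -> set N) (chi : I -> N -> Q) : Prop :=
  [/\ forall i, open (U i),
      forall x, exists i, U i x &
      forall i, locally_defines F (U i) (chi i)].

End foliation.

Definition euclidean_space (n : nat) : charted_space n :=
  @ChartedSpace n 'cV[R]_n [set Chart setT id id].

Section discrete.
Variable T : choiceType.

Definition point_chart (x : T) : chart (discrete_topology T) 0 :=
  @Chart (discrete_topology T) 0 [set x] (fun=> 0) (fun=> x).

(* T as a 0-dimensional manifold *)
Definition discrete_space : charted_space 0 :=
  @ChartedSpace 0 (discrete_topology T) (range point_chart).

End discrete.

End charts.

Definition GLZ (n : nat) := {A : 'M[int]_n | A \in unitmx}.

Section projective.
Variables (R : realType) (l : nat).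

Definition nzvec : Type := [set v : 'cV[R]_l.+1 | v != 0].
HB.instance Definition _ := Topological.on nzvec.

Definition collinear (u v : nzvec) : bool :=
  `[< exists2 a : R, a != 0 & \val u = a *: \val v >].

Lemma collinear_refl : reflexive collinear.
Proof. by move=> u; apply/asboolP; exists 1; rewrite ?oner_eq0 ?scale1r. Qed.

Lemma collinear_sym : symmetric collinear.
Proof.
have sub u v : collinear u v -> collinear v u.
  move=> /asboolP[a a0 e]; apply/asboolP; exists a^-1; first by rewrite invr_eq0.
  by rewrite e scalerA mulVf // scale1r.
by move=> u v; apply/idP/idP; exact: sub.
Qed.

Lemma collinear_trans : transitive collinear.
Proof.
move=> v u w /asboolP[a a0 e] /asboolP[b b0 e']; apply/asboolP; exists (a * b).
  by rewrite mulf_neq0.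
by rewrite e e' scalerA.
Qed.

Canonical collinear_equiv :=
  EquivRel collinear collinear_refl collinear_sym collinear_trans.

(* RP^l, as the quotient space of R^(l + 1) minus the origin *)
Definition RP : Type := quotient_topology {eq_quot collinear_equiv}.
HB.instance Definition _ := Topological.on RP.

Lemma const_neq0 : [set v : 'cV[R]_l.+1 | v != 0] (const_mx 1).
Proof.
by apply/eqP => /matrixP/(_ ord0 ord0); rewrite !mxE => /eqP; rewrite oner_eq0.
Qed.

Definition nzvec1 : nzvec := exist (fun v => v \in _) _ (mem_set const_neq0).

(* [v], the class of v <> 0; the junk value at 0 is never used *)
Definition RP_class (v : 'cV[R]_l.+1) : RP :=
  \pi_{eq_quot collinear_equiv} (insubd nzvec1 v).

(* homogeneous coordinates of p *)
Definition RP_coord (p : RP) : 'cV[R]_l.+1 :=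
  \val (repr (p : {eq_quot collinear_equiv})).

Lemma RP_coord_neq0 p : RP_coord p != 0.
Proof. exact: set_mem (valP (repr (p : {eq_quot collinear_equiv}))). Qed.

Lemma RP_coordK p : RP_class (RP_coord p) = p.
Proof. by rewrite /RP_class /RP_coord valKd reprK. Qed.

Lemma RP_class_eq u v : u != 0 -> v != 0 ->
  RP_class u = RP_class v <-> exists2 a : R, a != 0 & u = a *: v.
Proof.
move=> u0 v0; have su := mem_set (u0 : [set v : 'cV[R]_l.+1 | v != 0] u).
have sv := mem_set (v0 : [set v : 'cV[R]_l.+1 | v != 0] v).
rewrite /RP_class; split => [/eqmodP|uv].
  by move=> /asboolP /=; rewrite !insubdK.
by apply/eqmodP/asboolP => /=; rewrite !insubdK.
Qed.

(* [x_0 : ... : x_l] |-> (x_j / x_i)_(j <> i) on x_i <> 0 *)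
Definition affine_chart (i : 'I_l.+1) : chart R RP l :=
  Chart [set p | RP_coord p i 0 != 0]
    (fun p => \col_j (RP_coord p (lift i j) 0 / RP_coord p i 0))
    (fun y => RP_class (\col_j (if unlift i j is Some j' then y j' 0 else 1))).

Definition projective_space : charted_space R l :=
  @ChartedSpace R l RP (range affine_chart).

(* [A] : RP^l -> RP^l, [v] |-> [A v] *)
Definition RP_map (A : GLZ l.+1) (p : RP) : RP :=
  RP_class (map_mx intr (\val A) *m RP_coord p).

Lemma RP_mapE A v : v != 0 ->
  RP_map A (RP_class v) = RP_class (map_mx intr (\val A) *m v).
Proof.
have nz w : w != 0 -> map_mx intr (\val A) *m w != 0 :> 'cV[R]_l.+1.
  have uA : (map_mx intr (\val A) : 'M[R]_l.+1) \in unitmx.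
    by rewrite unitmxE det_map_mx rmorph_unit // -unitmxE (valP A).
  apply: contra_neq => /(congr1 (mulmx (invmx (map_mx intr (\val A))))).
  by rewrite mulKmx // mulmx0.
move=> v0; have /RP_class_eq := RP_coordK (RP_class v).
case/(_ (RP_coord_neq0 _) v0) => a a0 e.
apply/RP_class_eq; rewrite ?nz ?RP_coord_neq0 //.
by exists a => //; rewrite e scalemxAr.
Qed.

(* the embedding R^l -> RP^l, x |-> [1 : x] *)
Definition RP_embed (x : 'cV[R]_l) : RP := RP_class (col_mx (1 : 'cV_1) x).

End projective.

Section structures.
Variables (R : realType) (k l : nat) (N : charted_space R (k + l)).
Variable F : set (chart R N (k + l)).

(* g is x |-> A x + t with A in GL(l; Z) and t in T *)
Definition GLZ_affine (T : set 'cV[R]_l) (g : 'cV[R]_l -> 'cV[R]_l) : Prop :=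
  exists A : GLZ l, exists2 t : 'cV[R]_l, T t &
    forall y, g y = map_mx intr (\val A) *m y + t.

Definition integral_vectors : set 'cV[R]_l :=
  range (map_mx intr : 'cV[int]_l -> 'cV[R]_l).

Section affine.
Variables (I : Type) (U : I -> set N) (chi : I -> N -> euclidean_space R l).

(* h is the map chi_i(U_ij) -> chi_j(U_ij), extended by junk values; with
   T = R^l (resp. Z^l) it is a restriction of an element of the semidirect
   product of GL(l; Z) with R^l (resp. Z^l). *)
Definition affine_transition (T : set 'cV[R]_l) (i j : I)
    (h : 'cV[R]_l -> 'cV[R]_l) : Prop :=
  [/\ smooth_on (chi i @` (U i `&` U j)) h,
      exists2 g, GLZ_affine T g &
        forall y, (chi i @` (U i `&` U j)) y -> h y = g y &
      forall x, (U i `&` U j) x -> chi j x = h (chi i x)].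

Definition transversal_Zaffine : Prop :=
  submersion_atlas F U chi /\
  forall i j, U i `&` U j !=set0 -> exists h, affine_transition setT i j h.

(* The values of h_ij on chi_i(U_ij) are determined by chi_i and chi_j, so both
   clauses are about the same maps. *)
Definition strong_transversal_Zaffine : Prop :=
  transversal_Zaffine /\
  forall i j, U i `&` U j !=set0 ->
    exists h, affine_transition integral_vectors i j h.

End affine.

Definition transversal_Zprojective (I : Type) (U : I -> set N)
    (chi : I -> N -> projective_space R l) : Prop :=
  submersion_atlas F U chi /\
  exists A : I -> I -> N -> discrete_space R (GLZ l.+1),
    (forall i j, U i `&` U j !=set0 ->
       smooth_map_on (U i `&` U j) (A i j) /\
       forall x, (U i `&` U j) x -> chi j x = RP_map (A i j x) (chi i x)) /\
    (forall i j m x, (U i `&` U j `&` U m) x ->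
       \val (A i m x : GLZ l.+1) =
       \val (A j m x : GLZ l.+1) *m \val (A i j x : GLZ l.+1)).

End structures.

(* Main.v *)
(* The embedding y |-> [1 : y] intertwines y |-> A y + t with the projective map
   of the block matrix [[1, 0], [t, A]], which lies in GL(l + 1; Z) because t is
   integral; it is a diffeomorphism onto its image, since in the affine charts
   of RP^l it is a change of affine coordinates. The cocycle condition holds
   because (A, t) is determined near each point by chi_j = A chi_i + t:
   differentiating gives A, as d chi_i is surjective, and then t. *)
Require Import Defs.
From HB Require Import structures.
From mathcomp Require Import all_boot all_order all_algebra.
From mathcomp Require Import all_classical all_reals all_analysis.

Set Implicit Arguments.
Unset Strict Implicit.
Unset Printing Implicit Defensive.

Import Order.TTheory GRing.Theory Num.Theory.
Import numFieldNormedType.Exports.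

Local Open Scope classical_set_scope.
Local Open Scope ring_scope.

(** * Locality of the differential, and matrix-valued maps entry by entry *)

Section differential.
Variables (R : realType) (V : normedModType R).

(** The first-order expansion of [f] at [x] is also one of [g], since the two remainders agree near
    0; uniqueness of the linear part then identifies the differentials. *)
Lemma near_eq_diff (W : normedModType R) (f g : V -> W) (x : V) :
  {near x, f =1 g} -> differentiable f x ->
  differentiable g x /\ 'd g x = 'd f x :> (V -> W).
Proof.
move=> fg df; have [dfc dfx] := (diff_locallyP x f).1 df.
have gx : g \o shift x = cst (g x) + 'd f x +o_ 0 id.
  apply/eqaddoP => e e0; have := (eqaddoP _ _ _ _).1 dfx e e0.
  have : \forall h \near (0 : V), f (h + x) = g (h + x).
    by move: fg; rewrite [X in X -> _](near_shift 0) subr0.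
  apply: filterS2 => h fgh.
  by rewrite !fctE /= fgh (nbhs_singleton fg).
have dgf : 'd g x = 'd f x :> (V -> W) by exact: diff_unique.
by split=> //; apply/diff_locallyP; rewrite dgf.
Qed.

Lemma continuous_mx m n (f : V -> 'M[R]_(m, n)) (x : V) :
  (forall i j, {for x, continuous (fun y => f y i j)}) ->
  {for x, continuous f}.
Proof.
move=> cf A [P fP PA].
have : \forall y \near x, forall ij : 'I_m * 'I_n, P ij.1 ij.2 (f y ij.1 ij.2).
  by apply: filter_forall => -[i j]; apply: cf; exact: fP.
by apply: filterS => y Py; apply: PA => i j; exact: (Py (i, j)).
Qed.

Lemma differentiable_mx m n (f : V -> 'M[R]_(m, n)) (x : V) :
  (forall i j, differentiable (fun y => f y i j) x) -> differentiable f x.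
Proof.
move=> df.
have -> : f = \sum_(i < m) \sum_(j < n) fun y => f y i j *: delta_mx i j.
  apply/funext => y; rewrite fct_sumE [LHS]matrix_sum_delta.
  by apply: eq_bigr => i _; rewrite fct_sumE.
apply: differentiable_sum => i; apply: differentiable_sum => j.
exact: differentiableZl.
Qed.

Lemma differentiable_entry m n (f : V -> 'M[R]_(m, n)) (x : V) i j :
  differentiable f x -> differentiable (fun y => f y i j) x.
Proof.
move=> df.
exact: (differentiable_comp df (differentiable_coord (f x) i j)).
Qed.

Lemma derive_entry m n (f : V -> 'M[R]_(m, n)) (x v : V) i j :
  differentiable f x -> 'D_v (fun y => f y i j) x = ('D_v f x) i j.
Proof. by move=> df; rewrite derive_mx ?mxE //; exact: diff_derivable. Qed.

End differential.

(** * Closure properties of C^k maps on open sets *)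

Section ck.
Variables (R : realType) (V : normedModType R).

Lemma ck_on_subset (W : normedModType R) k (D E : set V) (f : V -> W) :
  D `<=` E -> ck_on k E f -> ck_on k D f.
Proof.
move=> DE; elim: k f => [|k IH] f /=; first by move=> cf x /DE /cf.
by move=> [df Df]; split=> [x /DE /df //|v]; exact: IH.
Qed.

(** Openness of [D] turns equality on [D] into equality near each of its points, so that derivatives
    agree on [D] as well. This lets a derivative be replaced by its formula from the product or
    quotient rule. *)
Lemma ck_on_eq (W : normedModType R) k (D : set V) (f g : V -> W) :
  open D -> (forall x, D x -> f x = g x) -> ck_on k D f -> ck_on k D g.
Proof.
move=> oD; elim: k f g => [|k IH] f g fg /=.
  move=> cf x Dx; have fx : f @ x --> f x := cf x Dx.
  rewrite (fg x Dx) in fx; apply: cvg_trans fx; apply: near_eq_cvg.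
  by move: (open_nbhs_nbhs (conj oD Dx)); apply: filterS => y /fg.
have nfg x : D x -> {near x, f =1 g}.
  by move=> Dx; move: (open_nbhs_nbhs (conj oD Dx)); apply: filterS => y /fg.
move=> [df Df]; split=> [x Dx|v].
  exact: (near_eq_diff (nfg x Dx) (df x Dx)).1.
apply: IH (Df v) => x Dx; exact/near_eq_derive/nfg.
Qed.

Lemma ck_onW (W : normedModType R) k (D : set V) (f : V -> W) :
  ck_on k.+1 D f -> ck_on k D f.
Proof.
elim: k f => [|k IH] f [df Df].
  by move=> x /df; exact: differentiable_continuous.
by split=> // v; exact: IH.
Qed.

Lemma ck_on_cst (W : normedModType R) k (D : set V) (a : W) :
  ck_on k D (fun=> a).
Proof.
elim: k a => [|k IH] a; first by move=> x _; exact: cvg_cst.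
split=> [x _|v]; first exact: differentiable_cst.
have -> : 'D_v (fun=> a : W) = (fun=> 0 : W) :> (V -> W).
  by apply/funext => x; exact: derive_cst.
exact: IH.
Qed.

Lemma ck_on_id k (D : set V) : ck_on k D (id : V -> V).
Proof.
case: k => [|k]; first by move=> x _; exact: cvg_id.
split=> [x _|v]; first exact: ex_diff.
have -> : 'D_v id = (fun=> v) :> (V -> V).
  by apply/funext => x; exact: derive_id.
exact: ck_on_cst.
Qed.

Lemma ck_onD (W : normedModType R) k (D : set V) (f g : V -> W) :
  open D -> ck_on k D f -> ck_on k D g -> ck_on k D (fun x => f x + g x).
Proof.
move=> oD; elim: k f g => [|k IH] f g.
  by move=> cf cg x Dx; apply: cvgD; [exact: cf|exact: cg].
move=> [df Df] [dg Dg]; split=> [x Dx|v].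
  by apply: differentiableD; [exact: df|exact: dg].
apply: ck_on_eq (IH _ _ (Df v) (Dg v)) => // x Dx.
by rewrite deriveD //; apply: diff_derivable; [exact: df|exact: dg].
Qed.

Lemma ck_onM k (D : set V) (f g : V -> R) :
  open D -> ck_on k D f -> ck_on k D g -> ck_on k D (fun x => f x * g x).
Proof.
move=> oD; elim: k f g => [|k IH] f g.
  by move=> cf cg x Dx; apply: cvgM; [exact: cf|exact: cg].
(* The product rule involves [f] and [g] undifferentiated, so both are also needed with their order
   lowered by one. *)
move=> /[dup] /ck_onW cf [df Df] /[dup] /ck_onW cg [dg Dg]; split=> [x Dx|v].
  by apply: differentiableM; [exact: df|exact: dg].
apply: ck_on_eq (ck_onD oD (IH _ _ cf (Dg v)) (IH _ _ cg (Df v))) => // x Dx.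
by rewrite deriveM //; apply: diff_derivable; [exact: df|exact: dg].
Qed.

Lemma ck_onV k (D : set V) (f : V -> R) :
  open D -> (forall x, D x -> f x != 0) ->
  ck_on k D f -> ck_on k D (fun x => (f x)^-1).
Proof.
move=> oD f0; elim: k => [|k IH].
  by move=> cf x Dx; apply: cvgV; [exact: f0|exact: cf].
move=> /[dup] /ck_onW /IH cf [df Df]; split=> [x Dx|v].
  by apply: differentiableV; [exact: df|exact: f0].
(* The derivative of 1/f is written as (-1) (1/f) (1/f) times that of f, where 1/f is C^k by
   induction. *)
have := ck_onM oD (ck_onM oD (ck_on_cst k D (-1 : R)) (ck_onM oD cf cf)) (Df v).
apply: ck_on_eq => // x Dx.
rewrite deriveV ?f0 //; last by apply: diff_derivable; exact: df.
by rewrite mulN1r -invfM -expr2.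
Qed.

Lemma ck_on_entry m n k (D : set V) (f : V -> 'M[R]_(m, n)) i j :
  open D -> ck_on k D f -> ck_on k D (fun x => f x i j).
Proof.
move=> oD; elim: k f => [|k IH] f.
  move=> cf x Dx.
  exact: (continuous_comp (cf x Dx) (@coord_continuous _ _ _ i j _)).
move=> [df Df]; split=> [x Dx|v]; first exact/differentiable_entry/df.
by apply: ck_on_eq (IH _ (Df v)) => // x Dx; rewrite derive_entry //; exact: df.
Qed.

Lemma ck_on_mx m n k (D : set V) (f : V -> 'M[R]_(m, n)) :
  open D -> (forall i j, ck_on k D (fun x => f x i j)) -> ck_on k D f.
Proof.
move=> oD; elim: k f => [|k IH] f cf.
  by move=> x Dx; apply: continuous_mx => i j; exact: cf.
have df x : D x -> differentiable f x.
  by move=> Dx; apply: differentiable_mx => i j; exact: (cf i j).1.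
split=> // v; apply: IH => i j; apply: ck_on_eq ((cf i j).2 v) => // x Dx.
by rewrite derive_entry //; exact: df.
Qed.

End ck.

(** * Affine charts of RP^l and their changes of coordinates *)

Section projective_charts.
Variables (R : realType) (l : nat).
Implicit Types (a b : 'I_l.+1) (y : 'cV[R]_l) (v : 'cV[R]_l.+1).

(** [homog a] and [dehomog a] are the affine chart and its inverse at the level of vectors, free of
    the arbitrary representative chosen by [RP_coord]. *)
Definition homog a y : 'cV[R]_l.+1 :=
  \col_j (if unlift a j is Some j' then y j' 0 else 1).

Definition dehomog a (v : 'cV[R]_l.+1) : 'cV[R]_l :=
  \col_j (v (lift a j) 0 / v a 0).

(* the change of affine coordinates from x_a <> 0 to x_b <> 0 *)
Definition transition a b y : 'cV[R]_l := dehomog b (homog a y).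

Lemma homogK a y : homog a y a 0 = 1.
Proof. by rewrite mxE unlift_none. Qed.

Lemma homog_lift a y j : homog a y (lift a j) 0 = y j 0.
Proof. by rewrite mxE liftK. Qed.

Lemma homog_neq0 a y : homog a y != 0.
Proof.
by apply/eqP => /matrixP/(_ a 0)/eqP; rewrite homogK mxE oner_eq0.
Qed.

Lemma homog_dehomog a v : v a 0 != 0 -> homog a (dehomog a v) = (v a 0)^-1 *: v.
Proof.
move=> va0; apply/colP => j; rewrite [LHS]mxE [RHS]mxE.
by case: unliftP => [j'|] ->; rewrite ?mxE ?mulVf // mulrC.
Qed.

Lemma dehomogZ a (s : R) v : s != 0 -> dehomog a (s *: v) = dehomog a v.
Proof.
by move=> s0; apply/colP => j; rewrite !mxE -mulf_div divff // mul1r.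
Qed.

Lemma dehomogK a y : dehomog a (homog a y) = y.
Proof. by apply/colP => j; rewrite mxE homogK homog_lift divr1. Qed.

Lemma transitionK a b y :
  homog a y b 0 != 0 -> transition b a (transition a b y) = y.
Proof.
move=> yb0; rewrite /transition homog_dehomog // dehomogZ ?invr_eq0 //.
exact: dehomogK.
Qed.

Lemma homog_transition_neq0 a b y :
  homog a y b 0 != 0 -> homog b (transition a b y) a 0 != 0.
Proof.
by move=> yb0; rewrite /transition homog_dehomog // mxE homogK mulr1 invr_eq0.
Qed.

(** The representative chosen by [RP_coord] differs from [v] by a nonzero scalar, which cancels in
    the quotients of coordinates. *)
Lemma affine_chart_class b v :
  v != 0 -> affine_chart R b (RP_class v) = dehomog b v.
Proof.
move=> v0.
have [s s0 e] := (RP_class_eq (RP_coord_neq0 _) v0).1 (RP_coordK (RP_class v)).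
by rewrite -(dehomogZ b v s0) -e.
Qed.

Lemma affine_chart_dom b v :
  v != 0 -> cdom (affine_chart R b) (RP_class v) <-> v b 0 != 0.
Proof.
move=> v0.
have [s s0 e] := (RP_class_eq (RP_coord_neq0 _) v0).1 (RP_coordK (RP_class v)).
by rewrite /= e mxE mulf_eq0 negb_or s0.
Qed.

(** Identifies [RP_embed] with the inverse of the affine chart of index 0; read in the chart of
    index [b], the embedding then becomes [transition ord0 b]. *)
Lemma homog0E y : homog ord0 y = col_mx (1 : 'cV_1) y.
Proof.
apply/colP => j; rewrite mxE; case: unliftP => [j'|] ->.
  have -> : lift ord0 j' = rshift 1 j' by apply: val_inj.
  by rewrite (@col_mxEd _ 1 l 1).
have -> : ord0 = lshift l (ord0 : 'I_1) by apply: val_inj.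
by rewrite (@col_mxEu _ 1 l 1) mxE.
Qed.

Lemma RP_embedE y : RP_embed y = RP_class (homog ord0 y).
Proof. by rewrite homog0E. Qed.

Lemma affine_chart_embed b y :
  affine_chart R b (RP_embed y) = transition ord0 b y.
Proof. by rewrite RP_embedE affine_chart_class ?homog_neq0. Qed.

Lemma affine_chart_dom_embed b y :
  cdom (affine_chart R b) (RP_embed y) <-> homog ord0 y b 0 != 0.
Proof. by rewrite RP_embedE affine_chart_dom ?homog_neq0. Qed.

Section smooth.
Variable V : normedModType R.

Lemma ck_on_homog k (D : set V) (f : V -> 'cV[R]_l) a :
  open D -> ck_on k D f -> ck_on k D (homog a \o f).
Proof.
move=> oD cf; apply: ck_on_mx => // i j; rewrite [j]ord1.
case: (unliftP a i) => [i'|] ->.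
  have -> : (fun x => (homog a \o f) x (lift a i') 0) = (fun x => f x i' 0).
    by apply/funext => x; exact: homog_lift.
  exact: ck_on_entry.
have -> : (fun x => (homog a \o f) x a 0) = (fun=> 1).
  by apply/funext => x; exact: homogK.
exact: ck_on_cst.
Qed.

(** Each entry is a quotient of entries of [homog a \o f], whose denominator does not vanish on
    [D]. *)
Lemma ck_on_transition k (D : set V) (f : V -> 'cV[R]_l) a b :
  open D -> (forall x, D x -> homog a (f x) b 0 != 0) ->
  ck_on k D f -> ck_on k D (transition a b \o f).
Proof.
move=> oD nz cf; apply: ck_on_mx => // i j; rewrite [j]ord1.
have -> : (fun x => (transition a b \o f) x i 0) =
    (fun x => homog a (f x) (lift b i) 0 * (homog a (f x) b 0)^-1).
  by apply/funext => x; rewrite /= mxE.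
have ch c : ck_on k D (fun x => homog a (f x) c 0).
  by apply: ck_on_entry => //; exact: ck_on_homog.
by apply: ck_onM => //; exact: ck_onV.
Qed.

End smooth.

Lemma continuous_homog a : continuous (homog a).
Proof. by move=> y; apply: (ck_on_homog a openT (@ck_on_id _ _ 0 setT)). Qed.

Lemma open_homog_neq0 a b : open [set y | homog a y b 0 != 0].
Proof.
have cf : continuous (fun y => homog a y b 0).
  move=> y.
  exact: (continuous_comp (@continuous_homog a y)
    (@coord_continuous _ _ _ b 0 _)).
by apply: (open_comp (fun y _ => cf y) (@open_neq R 0)).
Qed.

Lemma differentiable_transition a b y :
  homog a y b 0 != 0 -> differentiable (transition a b) y.
Proof.
move=> yb0.
have := @ck_on_transition _ 1 [set z | homog a z b 0 != 0] id a b.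
by case=> [||| + _]; [exact: open_homog_neq0|by []|exact: ck_on_id|exact].
Qed.

(** Chain rule for [transitionK], which holds on a neighbourhood of [y] because the nonvanishing
    condition is open. *)
Lemma diff_transitionK a b y : homog a y b 0 != 0 ->
  'd (transition b a) (transition a b y) \o 'd (transition a b) y
    = id :> ('cV[R]_l -> 'cV[R]_l).
Proof.
move=> yb0; rewrite -diff_comp; first last.
- exact/differentiable_transition/homog_transition_neq0.
- exact: differentiable_transition.
have e : {near y, id =1 transition b a \o transition a b}.
  have yD : [set z | homog a z b 0 != 0] y by [].
  move: (open_nbhs_nbhs (conj (@open_homog_neq0 a b) yD)).
  by apply: filterS => z /transitionK /= ->.
by rewrite (near_eq_diff e ex_diff).2 diff_val.
Qed.

Lemma diff_transition_inj a b y :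
  homog a y b 0 != 0 -> injective ('d (transition a b) y).
Proof.
move=> /diff_transitionK e; apply: can_inj => v.
exact: (congr1 (@^~ v) e).
Qed.

Lemma diff_transition_surj a b y : homog a y b 0 != 0 ->
  set_surj setT setT ('d (transition a b) y).
Proof.
move=> yb0 v _; exists ('d (transition b a) (transition a b y) v) => //.
(* The previous identity is used with [a] and [b] exchanged, at the point [transition a b y]; this
   gives the right inverse. *)
have := diff_transitionK (homog_transition_neq0 yb0).
by rewrite transitionK // => /(congr1 (@^~ v)).
Qed.

Lemma continuous_RP_embed : continuous (@RP_embed R l).
Proof.
(* [nzvec] has the topology induced from R^(l + 1), so continuity is tested after inclusion; the
   default of [insubd] is never reached. *)
have csub : continuous (fun y => insubd (nzvec1 R l) (homog ord0 y) : nzvec R l).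
  apply: continuous_comp_initial.
  rewrite (_ : _ \o _ = homog ord0); first exact: continuous_homog.
  by apply/funext => y; rewrite /= set_valE insubdK //; exact/mem_set/homog_neq0.
move=> y; have -> : @RP_embed R l = (\pi_(RP R l))%qT \o
    (fun y => insubd (nzvec1 R l) (homog ord0 y)).
  by apply/funext => z; rewrite RP_embedE.
apply: continuous_comp; [exact: csub|exact: pi_continuous].
Qed.

End projective_charts.

(** * Submersions defining the foliation, read in charts *)

Section charts.
Variable R : realType.

Lemma open_chart_image (T : topologicalType) n (c : chart R T n) (A : set T) :
  is_chart c -> open A -> open (c @` (A `&` cdom c)).
Proof.
move=> [od oi ck _ ci] oA.
have -> : c @` (A `&` cdom c) = c @` cdom c `&` cinv c @^-1` A.
  apply/seteqP; split => [_ [x [Ax cx] <-]|_ [[x cx <-]]] /=.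
    by split; [exact: imageP|rewrite /= ck].
  by rewrite ck // => Ax; exists x.
by apply: (continuous_inP _ oi).1 oA; rewrite -continuous_open_subspace.
Qed.

Variables (k l : nat) (N : charted_space R (k + l)).
Variable F : set (chart R N (k + l)).
Hypotheses (hN : is_manifold N) (hF : is_foliation F).
Variables (U : set N) (f : N -> euclidean_space R l).
Hypotheses (oU : open U) (hf : locally_defines F U f).

Let manifold_chart c : @atlas R _ N c -> is_chart c.
Proof. by case: hN => _ _ + _ _; exact. Qed.

Lemma local_rep_smooth (c : chart R N (k + l)) :
  @atlas R _ N c -> smooth_on (c @` (U `&` cdom c)) (f \o cinv c).
Proof.
move=> Nc r.
have := hf.1.1.2 c (Chart setT id id) Nc erefl r.
by rewrite /= preimage_setT setIT.
Qed.

Lemma local_rep_differentiable (c : chart R N (k + l)) x :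
  @atlas R _ N c -> cdom c x -> U x -> differentiable (f \o cinv c) (c x).
Proof. by move=> Nc cx Ux; apply: (local_rep_smooth Nc 1).1; exists x. Qed.

(** Smoothness of [f] is given only in charts of the atlas of [N]. A foliated chart is handled by
    factoring through such a chart [a] around [x], using the compatibility of the two. *)
Lemma foliated_rep_differentiable (c : chart R N (k + l)) x :
  F c -> cdom c x -> U x -> differentiable (f \o cinv c) (c x).
Proof.
move=> Fc cx Ux; have [_ _ _ /(_ x)[a Na ax] _] := hN.
have [Fchart Fa _ _ _] := hF.
have [_ _ cK _ _] := Fchart c Fc; have [oa _ aK _ _] := manifold_chart Na.
have D1 : differentiable (a \o cinv c) (c x).
  by apply: ((Fa c a Fc Na).1 1).1; exists x.
have D2 : differentiable (f \o cinv a) ((a \o cinv c) (c x)).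
  by rewrite /= cK //; exact: local_rep_differentiable.
have e : {near c x, (f \o cinv a) \o (a \o cinv c) =1 f \o cinv c}.
  have xD : (c @` (cdom a `&` cdom c)) (c x) by exists x.
  move: (open_nbhs_nbhs (conj (open_chart_image (Fchart c Fc) oa) xD)).
  by apply: filterS => _ [y [ay cy] <-]; rewrite /= cK // aK.
exact: (near_eq_diff e (differentiable_comp D1 D2)).1.
Qed.

Lemma local_rep_diff_surj (c : chart R N (k + l)) x :
  @atlas R _ N c -> cdom c x -> U x ->
  set_surj setT setT ('d (f \o cinv c) (c x)).
Proof.
by move=> Nc cx Ux; exact: (hf.1.2 x c (Chart setT id id) Ux Nc cx erefl).
Qed.

Lemma local_rep_RP_embed (c : chart R N (k + l)) b :
  local_rep (Q := projective_space R l) c (affine_chart R b)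
    (fun x => RP_embed (f x)) = transition ord0 b \o (f \o cinv c).
Proof. by apply/funext => z; exact: affine_chart_embed. Qed.

(** Here [c] need not belong to either atlas: the formula serves manifold charts in the submersion
    condition and foliated charts in the kernel condition. *)
Lemma diff_local_rep_RP_embed (c : chart R N (k + l)) b x :
  cinv c (c x) = x -> homog ord0 (f x) b 0 != 0 ->
  differentiable (f \o cinv c) (c x) ->
  'd (local_rep (Q := projective_space R l) c (affine_chart R b)
    (fun x => RP_embed (f x))) (c x) =
  'd (transition ord0 b) (f x) \o 'd (f \o cinv c) (c x)
    :> ('cV[R]_(k + l) -> 'cV[R]_l).
Proof.
move=> cK nz df.
have D2 : differentiable (transition ord0 b) ((f \o cinv c) (c x)).
  by apply: differentiable_transition; rewrite /comp cK.
rewrite local_rep_RP_embed; have := diff_comp df D2.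
by rewrite [in X in _ = X -> _]/comp cK.
Qed.

(** In charts, [f] is followed by a change of affine coordinates. Its differential is bijective,
    hence preserves both the surjectivity and the kernel of the differential of [f]. *)
Lemma locally_defines_RP_embed :
  locally_defines F U
    ((fun x => RP_embed (f x)) : N -> projective_space R l).
Proof.
have [_ _ Nchart _ _] := hN; have [Fchart _ _ _ _] := hF.
have cf : forall x, U x -> {for x, continuous f} := hf.1.1.1.
split; [split; [split|]|].
- move=> x Ux; apply: (continuous_comp (cf x Ux)).
  exact: continuous_RP_embed.
- move=> c _ Nc [b _ <-] r.
  rewrite local_rep_RP_embed.
  have [oc _ cK _ _] := Nchart c Nc.
  pose D : set 'cV[R]_l := [set y | homog ord0 y b 0 != 0].
  have -> : (fun x => RP_embed (f x)) @^-1` cdom (affine_chart R b) = f @^-1` D.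
    by apply/seteqP; split => x /affine_chart_dom_embed.
  have oUD : open (U `&` f @^-1` D).
    apply: (continuous_inP f oU).1 => [x /set_mem /cf //|].
    exact: open_homog_neq0.
  rewrite setIAC; apply: ck_on_transition.
  + exact: open_chart_image (Nchart c Nc) oUD.
  + by move=> _ [x [[Ux Dx] cx] <-]; rewrite /comp cK //; exact: Dx.
  + apply: ck_on_subset (local_rep_smooth Nc r).
    by apply: image_subset => x [[Ux _] cx].
- move=> x c _ Ux Nc cx [b _ <-] /affine_chart_dom_embed nz.
  have [_ _ cK _ _] := Nchart c Nc.
  rewrite diff_local_rep_RP_embed ?cK //; last exact: local_rep_differentiable.
  move=> v _; have [w _ <-] := diff_transition_surj nz (I : setT v).
  have [u _ <-] := local_rep_diff_surj Nc cx Ux (I : setT w).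
  by exists u.
- move=> x c _ Ux Fc cx [b _ <-] /affine_chart_dom_embed nz v.
  have [_ _ cK _ _] := Fchart c Fc.
  rewrite diff_local_rep_RP_embed ?cK //; last exact: foliated_rep_differentiable.
  (* The condition [dsubmx v = 0] is traded for the vanishing of the differential of [f] at [v], by
     the hypothesis on [f] in the identity chart. *)
  have <- := hf.2 x c (Chart setT id id) Ux Fc cx erefl I v.
  rewrite /=; split => [|->]; last exact: linear0.
  by rewrite -[X in _ = X](linear0 ('d (transition ord0 b) (f x)));
    exact: diff_transition_inj.
Qed.

(** Differentiating [B *m f y = t] at [x] shows that [B] kills the image of the differential of [f],
    which is all of R^l. *)
Lemma chart_mulmx_cst m (B : 'M[R]_(m, l)) (t : 'cV[R]_m) x (O : set N) :
  open O -> O `<=` U -> O x -> (forall y, O y -> B *m f y = t) -> B = 0.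
Proof.
move=> oO OU Ox Bf; have [_ _ Nchart /(_ x)[a Na ax] _] := hN.
have [_ _ aK _ _] := Nchart a Na.
have D1 := local_rep_differentiable Na ax (OU _ Ox).
(* A linear map is its own differential once it is known to be continuous. *)
have cB : continuous (mulmx B : 'cV[R]_l -> 'cV[R]_m).
  move=> y; apply/differentiable_continuous/differentiable_mx => i j.
  have -> : (fun y : 'cV[R]_l => (B *m y) i j) =
      \sum_(p < l) (fun y : 'cV[R]_l => B i p *: (y p j : R)).
    by apply/funext => z; rewrite mxE fct_sumE.
  apply: differentiable_sum => p; apply: differentiableZ.
  exact: differentiable_coord.
have D2 : differentiable (mulmx B : 'cV[R]_l -> 'cV[R]_m) ((f \o cinv a) (a x)).
  exact: linear_differentiable.
have e : {near a x, (fun=> t) =1 mulmx B \o (f \o cinv a)}.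
  have xD : (a @` (O `&` cdom a)) (a x) by exists x.
  move: (open_nbhs_nbhs (conj (open_chart_image (Nchart a Na) oO) xD)).
  by apply: filterS => _ [y [Oy ay] <-]; rewrite /= aK // Bf.
have dB : 'd (mulmx B : 'cV[R]_l -> 'cV[R]_m) ((f \o cinv a) (a x))
    = mulmx B :> ('cV[R]_l -> 'cV[R]_m) by exact: diff_lin.
have d0 := etrans (esym (diff_comp D1 D2))
  (near_eq_diff e (differentiable_cst _ _)).2.
rewrite dB diff_cst in d0.
apply/matrixP => i j; rewrite mxE.
(* A preimage of the [j]-th basis vector isolates the [j]-th column of [B]. *)
have [v _ vj] := local_rep_diff_surj Na ax (OU _ Ox) (I : setT (delta_mx j 0)).
have := congr1 (@^~ v) d0; rewrite /comp vj -colE => /matrixP/(_ i 0).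
by rewrite !mxE.
Qed.

End charts.

(** * Integral affine maps as block matrices in GL(l + 1; Z) *)

Section affine_to_projective.
Variable l : nat.
Implicit Types (A : GLZ l) (t : 'cV[int]_l).

Definition affine_mx A t : 'M[int]_l.+1 :=
  block_mx (1 : 'M[int]_1) (0 : 'M[int]_(1, l)) t (\val A).

Lemma affine_mx_unit A t : affine_mx A t \in unitmx.
Proof.
by rewrite unitmxE (@det_lblock _ 1 l) det1 mul1r -unitmxE; exact: (valP A).
Qed.

Definition affine_GLZ A t : GLZ l.+1 :=
  exist (fun B : 'M[int]_l.+1 => B \in unitmx) _ (affine_mx_unit A t).

Lemma RP_map_embed (R : realType) A t (y : 'cV[R]_l) :
  RP_map (affine_GLZ A t) (RP_embed y) =
  RP_embed (map_mx intr (\val A) *m y + map_mx intr t).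
Proof.
rewrite /RP_embed RP_mapE; last by rewrite -homog0E homog_neq0.
congr RP_class; rewrite /affine_GLZ /affine_mx /=.
rewrite (@map_block_mx _ _ _ 1 l 1 l) (@mul_block_col _ 1 l 1 l).
by rewrite map_mx1 map_mx0 mul1mx mul0mx addr0 mulmx1 addrC.
Qed.

Lemma affine_mxM A1 t1 A2 t2 : affine_mx A2 t2 *m affine_mx A1 t1 =
  block_mx (1 : 'M[int]_1) (0 : 'M[int]_(1, l))
    (\val A2 *m t1 + t2) (\val A2 *m \val A1).
Proof.
rewrite /affine_mx (@mulmx_block _ 1 l 1 l 1 l).
by rewrite !mul1mx !mulmx1 !mul0mx !mulmx0 !addr0 !add0r addrC.
Qed.

End affine_to_projective.

(** * Integral transition data, their choice and their cocycle condition *)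

Lemma map_mx_intr_inj (R : numDomainType) m n :
  injective (map_mx (intr : int -> R) : 'M[int]_(m, n) -> 'M[R]_(m, n)).
Proof.
move=> A B /matrixP AB; apply/matrixP => i j.
by apply: (@intr_inj R); have := AB i j; rewrite !mxE.
Qed.

(** Strongness provides integral translations; the axiom of choice then selects one pair (A, t) for
    every pair of indices at once. *)
Lemma strong_affine_matrices (R : realType) (k l : nat)
    (N : charted_space R (k + l)) (F : set (chart R N (k + l)))
    (I : Type) (U : I -> set N) (chi : I -> N -> euclidean_space R l) :
  strong_transversal_Zaffine F U chi ->
  exists At : I * I -> GLZ l * 'cV[int]_l,
    forall i j x, (U i `&` U j) x -> chi j x =
      map_mx intr (\val (At (i, j)).1) *m chi i x + map_mx intr (At (i, j)).2.
Proof.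
move=> [_ hst].
pose P (ij : I * I) (At : GLZ l * 'cV[int]_l) :=
  forall x, (U ij.1 `&` U ij.2) x ->
    chi ij.2 x = map_mx intr (\val At.1) *m chi ij.1 x + map_mx intr At.2.
suff /boolp.choice[At AtP] : forall ij, exists At, P ij At.
  by exists At => i j; exact: (AtP (i, j)).
(* On an empty overlap the condition is vacuous, and the identity with zero translation serves as
   default. *)
move=> [i j]; have [U0|U0] := pselect (U i `&` U j !=set0); last first.
  exists (exist (fun A : 'M[int]_l => A \in unitmx) _ (unitmx1 _ _), 0) => x Ux.
  by case: U0; exists x.
have [h [_ [g [A [_ [t _ <-] gE]] hg] hchi]] := hst i j U0.
by exists (A, t) => x Ux; rewrite /= hchi // hg ?gE //; exists x.
Qed.

Theorem corollary5p14 (R : realType) (k l : nat)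
    (N : charted_space R (k + l)) (hN : is_manifold N)
    (F : set (chart R N (k + l))) (hF : is_foliation F)
    (I : Type) (U : I -> set N) (chi : I -> N -> euclidean_space R l)
    (hchi : strong_transversal_Zaffine F U chi) :
  transversal_Zprojective F U (fun i x => RP_embed (chi i x)).
Proof.
have [[[oU covU defU] _] _] := hchi.
split; first by split=> // i; exact: locally_defines_RP_embed.
have [At AtP] := strong_affine_matrices hchi.
(* The matrix does not depend on the point of the overlap, so smoothness into the discrete space is
   that of constant maps. *)
exists (fun i j _ => affine_GLZ (At (i, j)).1 (At (i, j)).2); split.
  move=> i j _; split; last by move=> x Ux; rewrite RP_map_embed (AtP i j x Ux).
  split; first by move=> x _; exact: cvg_cst.
  by move=> c _ Nc [p _ <-] r; exact: ck_on_cst.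
move=> i j m x [[Ui Uj] Um]; rewrite affine_mxM.
set Aim := At (i, m); set Ajm := At (j, m); set Aij := At (i, j).
(* On the triple overlap, the direct transition from [i] to [m] and the one through [j] give two
   affine expressions of [chi m] in terms of [chi i]. *)
have e y : (U i `&` U j `&` U m) y ->
    map_mx intr (\val Aim.1) *m chi i y + map_mx intr Aim.2 =
    map_mx intr (\val Ajm.1 *m \val Aij.1) *m chi i y +
      map_mx intr (\val Ajm.1 *m Aij.2 + Ajm.2).
  move=> [[Uiy Ujy] Umy]; rewrite -(AtP i m y) // (AtP j m y) // (AtP i j y) //.
  by rewrite mulmxDr mulmxA map_mxD !map_mxM addrA.
have eA : \val Aim.1 = \val Ajm.1 *m \val Aij.1.
  apply: (@map_mx_intr_inj R); apply/eqP; rewrite -subr_eq0; apply/eqP.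
  have oO : open (U i `&` U j `&` U m) by apply: openI => //; exact: openI.
  (* By [e], the difference of the two linear parts applied to [chi i] is this constant, the
     opposite difference of the translations; [chart_mulmx_cst] then makes the linear parts
     equal. *)
  pose t : 'cV[R]_l :=
    map_mx intr (\val Ajm.1 *m Aij.2 + Ajm.2) - map_mx intr Aim.2.
  apply: (chart_mulmx_cst hN (defU i) oO (t := t) (x := x)) => //.
    by move=> y [[]].
  move=> y /e ey; rewrite mulmxBl /t.
  by apply/eqP; rewrite subr_eq addrAC -subr_eq opprK ey addrC.
have et : Aim.2 = \val Ajm.1 *m Aij.2 + Ajm.2.
  apply: (@map_mx_intr_inj R).
  (* With equal linear parts, the linear terms cancel at the single point [x], leaving the
     translations. *)
  by have := e x (conj (conj Ui Uj) Um); rewrite eA => /addrI.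
by rewrite /= /affine_mx eA et.
Qed.
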